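(* Let $X$ be a real random variable with distribution $\mu$ and distribution function $F(x)=\mu((-\infty,x])$, and let $K_\mu(x,y)=F(x\wedge y)-F(x)F(y)$ for $(x,y)\in\mathbb{R}^2$ (a non-negative and symmetric kernel). (a) If $a,b:\mathbb{R}\to\mathbb{R}$ are nondecreasing and left-continuous with $\mathrm{Var}(a(X))<\infty$ and $\mathrm{Var}(b(X))<\infty$, then $$\mathrm{Cov}[a(X),b(X)]=\iint_{\mathbb{R}^2}\{F(x\wedge y)-F(x)F(y)\}\,da(x)\,db(y)=\iint_{\mathbb{R}^2}K_\mu(x,y)\,da(x)\,db(y).$$ (b) Moreover, the same identity continues to hold if $a=a_1-a_2$ and $b=b_1-b_2$, where $a_j,b_j$ are nondecreasing and left-continuous with $a_j\in L_p(F)$ and $b_j\in L_q(F)$ for $j=1,2$, and $p^{-1}+q^{-1}=1$.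
   Context: $L_p(F)$ denotes $L_p$ of the probability measure $\mu$ with distribution function $F$. For $g$ nondecreasing and left-continuous, $dg$ denotes the associated Lebesgue–Stieltjes measure, $dg([\alpha,\beta))=g(\beta)-g(\alpha)$; for $g=g_1-g_2$ a difference of two such functions, integration against $dg$ means integration against $dg_1-dg_2$, extended bilinearly in the double integral. *)

(* Defs.v *)
From HB Require Import structures.
From mathcomp Require Import all_boot all_order all_algebra.
From mathcomp Require Import all_classical all_reals all_analysis.

Set Implicit Arguments.
Unset Strict Implicit.
Unset Printing Implicit Defensive.
Import Order.TTheory GRing.Theory Num.Theory.
Import numFieldNormedType.Exports.

Local Open Scope classical_set_scope.
Local Open Scope ring_scope.

Notation left_continuous f :=
  (forall x, f%function @ at_left x --> f%function x).

(* The left-continuous counterpart of [cumulative R R]. *)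
HB.mixin Record isLCumulative (R : realType) (g : R -> R) := {
  lcumulative_is_nondecreasing : nondecreasing g ;
  lcumulative_is_left_continuous : left_continuous g }.

#[short(type=lcumulative)]
HB.structure Definition LCumulative (R : realType) :=
  { g of isLCumulative R g }.

Section lstieltjes.
Context {R : realType}.

Definition mirror (g : R -> R) (x : R) : R := - g (- x).

Section mirror_cumulative.
Variable g : lcumulative R.

Let mirror_nd : nondecreasing (mirror g).
Proof.
by move=> x y xy; rewrite lerN2 lcumulative_is_nondecreasing// lerN2.
Qed.

Let mirror_rc : right_continuous (mirror g).
Proof.
move=> x; apply: (@cvgN _ R^o).
rewrite -[x in x^'+]opprK.
apply/(@cvg_at_leftNP R^o).
exact: lcumulative_is_left_continuous.
Qed.

HB.instance Definition _ :=
  isCumulative.Build R _ R (mirror g) mirror_nd mirror_rc.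
End mirror_cumulative.

(* The library's Stieltjes measures satisfy nu_f ]s, t] = f t - f s for a
   right-continuous f. For a left-continuous g, dg is the image of the measure
   nu_f under x |-> - x, where f x = - g (- x); see [lstieltjesE]. *)
Definition lstieltjes (g : lcumulative R) : set R -> \bar R :=
  pushforward (lebesgue_stieltjes_measure (mirror g))
    (-%R : measurableTypeR R -> R).

Section lstieltjes_measure.
Variable g : lcumulative R.
Local Open Scope ereal_scope.

Let mopp : measurable_fun [set: measurableTypeR R] (-%R : R -> R).
Proof. exact: measurable_realfun.oppr_measurable. Qed.

Let lstieltjes0 : lstieltjes g set0 = 0.
Proof. by rewrite /lstieltjes /pushforward preimage_set0 measure0. Qed.

Let lstieltjes_ge0 A : 0 <= lstieltjes g A.
Proof. exact: measure_ge0. Qed.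

Let lstieltjes_sigma_additive : semi_sigma_additive (lstieltjes g).
Proof.
move=> F mF tF mUF; rewrite /lstieltjes /pushforward preimage_bigcup.
have mN (A : set R) : measurable A ->
    measurable (-%R @^-1` A : set (measurableTypeR R)).
  by move=> mA; rewrite -[X in measurable X]setTI; exact: mopp.
apply: measure_semi_sigma_additive.
- by move=> n; exact: mN.
- apply/trivIsetP => /= i j _ _ ij; rewrite -preimage_setI.
  by move/trivIsetP : tF => /(_ _ _ _ _ ij) ->//; rewrite preimage_set0.
- by rewrite -preimage_bigcup; exact: mN.
Qed.

HB.instance Definition _ := isMeasure.Build _ R R (lstieltjes g)
  lstieltjes0 lstieltjes_ge0 lstieltjes_sigma_additive.

Lemma lstieltjesE (s t : R) : (s <= t)%R ->
  lstieltjes g `[s, t[ = (g t - g s)%:E.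
Proof.
move=> st; rewrite /lstieltjes /pushforward opp_preimage_itvbndbnd/=.
rewrite /lebesgue_stieltjes_measure /measure_extension/=.
rewrite measurable_mu_extE/=; last exact: is_ocitv.
by rewrite wlength_itv_bnd ?lerN2// /mirror !opprK addrC.
Qed.

Let lstieltjes_sigma_finite : sigma_finite [set: R] (lstieltjes g).
Proof.
exists (fun k => `[- k%:R, k%:R[%classic%R).
  apply/esym; rewrite -subTset => /= x _ /=.
  exists (Num.bound `|x|) => //=.
  have := archi_boundP (normr_ge0 x).
  by rewrite in_itv/= ltr_norml => /andP[/ltW -> ->].
move=> k; split; first exact: measurable_itv.
by rewrite lstieltjesE ?ltry// (@le_trans _ _ 0%R)// oppr_le0.
Qed.

HB.instance Definition _ := @Measure_isSigmaFinite.Build _ _ _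
  (lstieltjes g) lstieltjes_sigma_finite.

End lstieltjes_measure.
End lstieltjes.

Section covariance_kernel.
Context {R : realType}.
Local Open Scope ereal_scope.

(* [fine] is harmless: [mu] is a probability measure. *)
Definition dfun (mu : probability R R) (x : R) : R := fine (mu `]-oo, x]%classic).

Definition cov_kernel (mu : probability R R) (x y : R) : R :=
  (dfun mu (Num.min x y) - dfun mu x * dfun mu y)%R.

Definition iint (k : R -> R -> R) (a b : lcumulative R) : \bar R :=
  \int[lstieltjes a \x lstieltjes b]_z (k z.1 z.2)%:E.

(* Integral of k against (da1 - da2) \x (db1 - db2). In [\bar R] an opposite
   pair of infinities adds up to -oo, so that a finite value of this expression
   entails that its four terms are finite. *)
Definition iintB (k : R -> R -> R) (a1 a2 b1 b2 : lcumulative R) : \bar R :=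
  iint k a1 b1 - iint k a1 b2 - iint k a2 b1 + iint k a2 b2.

End covariance_kernel.

(* Main.v *)
(* For left-continuous nondecreasing a, b and s <= t,
     (a t - a s) (b t - b s) = (da \x db) ([s, t[ * [s, t[),
   and a pair (x, y) lies in [s, t[ * [s, t[ iff s <= min x y and max x y < t,
   an event of mu \x mu-probability F (min x y) (1 - F (max x y)) = K x y.
   Tonelli's theorem thus turns E[(a(X) - a(X')) (b(X) - b(X'))], for X' an
   independent copy of X, into twice the double integral of K; expanding the
   product shows that it is also twice Cov[a(X), b(X)] as soon as a(X), b(X)
   and a(X) b(X) are integrable. Part (b) follows by bilinearity, Hoelder's
   inequality providing the integrability of the products. *)
From HB Require Import structures.
Require Import Defs.
From mathcomp Require Import all_boot all_order all_algebra.
From mathcomp Require Import all_classical all_reals all_analysis.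
From mathcomp Require Import ess_sup_inf measurable_realfun.
From mathcomp Require Import ring lra.
Set Implicit Arguments.
Unset Strict Implicit.
Import Order.TTheory GRing.Theory Num.Theory.
Import numFieldNormedType.Exports.
Local Open Scope classical_set_scope.
Local Open Scope ring_scope.
Local Open Scope ereal_scope.

(** * The kernel as a product of two probabilities *)

Lemma cov_kernelC (R : realType) (mu : probability R R) (x y : R) :
  cov_kernel mu x y = cov_kernel mu y x.
Proof. by rewrite /cov_kernel minC mulrC. Qed.

(** Both sides are symmetric, and for [x <= y] both equal [F x (1 - F y)]. The factors are
    probabilities of two rays, whence non-negativity and [cov_kernel_prod]. *)
Lemma cov_kernelE (R : realType) (mu : probability R R) (x y : R) :
  cov_kernel mu x y =
    (dfun mu (Num.min x y) * (1 - dfun mu (Num.max x y)))%R.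
Proof.
wlog xy : x y / (x <= y)%R.
  by move=> H; case/orP: (le_total x y) => /H //; rewrite cov_kernelC minC maxC.
by rewrite /cov_kernel (min_idPl xy) (max_idPr xy); ring.
Qed.

Lemma dfunE (R : realType) (mu : probability R R) (x : R) :
  (dfun mu x)%:E = mu `]-oo, x]%classic.
Proof. by rewrite /dfun fineK ?fin_num_measure. Qed.

Lemma cov_kernel_ge0 (R : realType) (mu : probability R R) (x y : R) :
  (0 <= cov_kernel mu x y)%R.
Proof.
rewrite cov_kernelE mulr_ge0 ?fine_ge0// subr_ge0.
by rewrite -lee_fin dfunE probability_le1.
Qed.

Lemma cov_kernel_prod (R : realType) (mu : probability R R) (x y : R) :
  (mu \x mu) (`]-oo, Num.min x y]%classic `*` `]Num.max x y, +oo[%classic) =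
    (cov_kernel mu x y)%:E.
Proof.
rewrite product_measure1E//= -setCitvl probability_setC//.
by rewrite -!dfunE cov_kernelE EFinM EFinB.
Qed.

(** * Squares spanned by two samples, and Tonelli's theorem *)

Lemma lcumulative_measurable (R : realType) (g : lcumulative R) :
  measurable_fun [set: R] (g : R -> R).
Proof.
apply: nondecreasing_measurable => // x y xy.
exact: lcumulative_is_nondecreasing.
Qed.

(** The first pair holds the samples [(s, t)], the second the integration variables [(x, y)]. The
    half-open bounds match [lstieltjesE]. *)
Definition both_between {R : realType} : set ((R * R) * (R * R)) :=
  [set u | (u.1.1 <= u.2.1 < u.1.2) && (u.1.1 <= u.2.2 < u.1.2)]%R.

Lemma measurable_both_between (R : realType) : measurable (@both_between R).
Proof.
have m11 : measurable_fun [set: (R * R) * (R * R)] (fun u => u.1.1).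
  exact: measurableT_comp.
have m12 : measurable_fun [set: (R * R) * (R * R)] (fun u => u.1.2).
  exact: measurableT_comp.
have m21 : measurable_fun [set: (R * R) * (R * R)] (fun u => u.2.1).
  exact: measurableT_comp.
have m22 : measurable_fun [set: (R * R) * (R * R)] (fun u => u.2.2).
  exact: measurableT_comp.
have : measurable_fun setT (fun u : (R * R) * (R * R) =>
    (u.1.1 <= u.2.1 < u.1.2) && (u.1.1 <= u.2.2 < u.1.2))%R.
  by do 2!apply: measurable_and; (exact: measurable_fun_ler
    || exact: measurable_fun_ltr).
by move=> /(_ measurableT [set true] I); rewrite setTI.
Qed.

(** For [t < s] the interval is empty; this confines the later integral to one triangle. *)
Lemma lstieltjes_square (R : realType) (a b : lcumulative R) (s t : R) :
  (lstieltjes a \x lstieltjes b) (`[s, t[%classic `*` `[s, t[%classic) =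
    (if s <= t then (a t - a s) * (b t - b s) else 0)%R%:E.
Proof.
rewrite product_measure1E//=; case: leP => [st|ts].
  by rewrite !lstieltjesE// EFinM.
by rewrite set_itv_ge ?measure0 ?mul0e// bnd_simp -leNgt ltW.
Qed.

(* The canonical sigma-finite instance on [_ \x _] is the one for
   subprobabilities, hence the need for a new name. *)
Definition lstieltjes2 {R : realType} (a b : lcumulative R) :
  set (R * R) -> \bar R := lstieltjes a \x lstieltjes b.

HB.instance Definition _ (R : realType) (a b : lcumulative R) :=
  Measure.on (lstieltjes2 a b).

Lemma sigma_finite_lstieltjes2 (R : realType) (a b : lcumulative R) :
  sigma_finite setT (lstieltjes2 a b).
Proof.
exists (fun k => `[- k%:R, k%:R[%classic `*` `[- k%:R, k%:R[%classic)%R.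
  apply/esym; rewrite -subTset => -[x y] _.
  (* [archi_boundP] gives a strict bound, as the open right ends require. *)
  exists (Num.bound (Num.max `|x| `|y|)%R) => //=.
  have : (0 <= Num.max `|x| `|y|)%R by rewrite le_max normr_ge0.
  move/archi_boundP.
  rewrite gt_max !in_itv/= !ltr_norml.
  by move=> /andP[/andP[/ltW -> ->] /andP[/ltW -> ->]].
move=> k; split; first exact: measurableX.
by rewrite /lstieltjes2 lstieltjes_square ltry.
Qed.

HB.instance Definition _ (R : realType) (a b : lcumulative R) :=
  @Measure_isSigmaFinite.Build _ _ _ (lstieltjes2 a b)
    (sigma_finite_lstieltjes2 a b).

Lemma xsection_both_between (R : realType) (w : R * R) :
  xsection both_between w = `[w.1, w.2[%classic `*` `[w.1, w.2[%classic.
Proof.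
apply/seteqP; split => z; rewrite /xsection/= /both_between inE /= !in_itv/=.
  by move=> /andP[].
by move=> [-> ->].
Qed.

(** The constraints on [s] and [t] separate, so the section is a product set, measured by
    [cov_kernel_prod]. *)
Lemma ysection_both_between (R : realType) (z : R * R) :
  ysection both_between z =
    `]-oo, Num.min z.1 z.2]%classic `*` `]Num.max z.1 z.2, +oo[%classic.
Proof.
apply/seteqP; split => w; rewrite /ysection/= /both_between inE /= !in_itv/=.
  move=> /andP[/andP[? ?] /andP[? ?]]; rewrite le_min gt_max andbT.
  by split; apply/andP.
by rewrite le_min gt_max andbT => -[/andP[-> ->] /andP[-> ->]].
Qed.

Lemma integral_lstieltjes_square (R : realType) (mu : probability R R)
    (a b : lcumulative R) :
  let S (w : R * R) : \bar R := lstieltjes2 a b (xsection both_between w) in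
  measurable_fun [set: R * R] S /\
  \int[mu \x mu]_w S w = iint (cov_kernel mu) a b.
Proof.
have mB := @measurable_both_between R.
split; first exact: measurable_fun_xsection.
transitivity (\int[mu \x mu]_w
    fubini_F (lstieltjes2 a b) (EFin \o \1_both_between) w).
  by rewrite indic_fubini_tonelli_FE.
(* The same measure as [mu \x mu], packaged as a sigma-finite one for Tonelli's theorem. *)
pose mu2 := product_subprobability
  (mu : subprobability _ _, mu : subprobability _ _).
rewrite (@indic_fubini_tonelli _ _ _ _ _ mu2 (lstieltjes2 a b) _ mB).
rewrite indic_fubini_tonelli_GE//.
by apply: eq_integral => z _ /=; rewrite ysection_both_between cov_kernel_prod.
Qed.

(** * Symmetrization and the covariance of two monotone functions *)

(** Exchanging the order of integration gives [f] and [f \o swap_pair] the same integral, possibly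
    infinite since [f] is non-negative. *)
Lemma integral_symmetrization d (T : measurableType d) (R : realType)
    (m : {sigma_finite_measure set T -> \bar R}) (f : T * T -> \bar R) :
  measurable_fun setT f -> (forall w, 0 <= f w) ->
  \int[m]_s \int[m]_t (f (s, t) + f (t, s)) =
    \int[m \x m]_w f w + \int[m \x m]_w f w.
Proof.
move=> mf f0.
have mfs : measurable_fun setT (f \o swap_pair).
  by apply: measurableT_comp => //; exact: measurable_swap.
have fs0 w : 0 <= (f \o swap_pair) w by exact: f0.
rewrite {2}fubini_tonelli1// -(fubini_tonelli2 _ mfs fs0) -ge0_integralD//.
rewrite fubini_tonelli1//; first exact: emeasurable_funD.
by move=> w; rewrite adde_ge0.
Qed.

(* Each of the two triangles [s <= t] and [t <= s] contributes
   [iint (cov_kernel mu) a b]. *)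
Lemma integral_increments (R : realType) (mu : probability R R)
    (a b : lcumulative R) :
  \int[mu]_s \int[mu]_t ((a t - a s) * (b t - b s))%:E =
    iint (cov_kernel mu) a b + iint (cov_kernel mu) a b.
Proof.
have [mS <-] := integral_lstieltjes_square mu a b.
have S0 w : 0 <= lstieltjes2 a b (xsection both_between w) by [].
rewrite -(integral_symmetrization mu mS S0).
apply: eq_integral => s _; apply: eq_integral => t _.
rewrite !xsection_both_between /lstieltjes2 !lstieltjes_square/=.
(* On the diagonal both products of increments vanish. *)
by case: (ltgtP s t) => [_|_|->]; rewrite -EFinD; congr EFin; ring.
Qed.

(** These three integrability conditions cover both square-integrable and conjugate pairs. *)
Lemma covariance_cov_kernel (R : realType) (mu : probability R R)
    (a b : lcumulative R) :
  (a : R -> R) \in Lfun mu 1 -> (b : R -> R) \in Lfun mu 1 ->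
  (a \* b)%R \in Lfun mu 1 ->
  covariance mu a b = iint (cov_kernel mu) a b.
Proof.
move=> a1 b1 ab1; rewrite covarianceE//.
rewrite -[(_ * _)%R]/(a \* b)%R.
have cst1 r : cst r \in Lfun mu 1 by exact: Lfun_cst.
have Ea : (fine 'E_mu[a])%:E = 'E_mu[a] by rewrite fineK ?expectation_fin_num.
have Eb : (fine 'E_mu[b])%:E = 'E_mu[b] by rewrite fineK ?expectation_fin_num.
have Eab : (fine 'E_mu[a \* b])%:E = 'E_mu[a \* b].
  by rewrite fineK ?expectation_fin_num.
(* For fixed [s] this is linearity of expectation; integrating over [s] then gives [2 (E[ab] - E[a]
   E[b])]. *)
have inner s : \int[mu]_t ((a t - a s) * (b t - b s))%:E =
    (fine 'E_mu[a \* b] - b s * fine 'E_mu[a] - a s * fine 'E_mu[b]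
     + a s * b s)%:E.
  rewrite (_ : \int[mu]_t _ =
    'E_mu[(a \* b \- b s \o* a \- a s \o* b \+ cst (a s * b s))%R]).
    rewrite expectationD ?expectation_cst ?expectationB ?expectationZl
      ?cst1 ?rpredB ?cst1 ?Lfun_scale//.
    by rewrite -Ea -Eb -Eab.
  by rewrite unlock; apply: eq_integral => t _ /=; congr EFin; ring.
have := integral_increments mu a b.
rewrite (eq_integral _ _ (fun s _ => inner s)).
set I := iint _ _ _.
rewrite (_ : \int[mu]_s _ =
  'E_mu[(cst (fine 'E_mu[a \* b]) \- fine 'E_mu[a] \o* b
        \- fine 'E_mu[b] \o* a \+ (a \* b))%R]); last first.
  by rewrite unlock; apply: eq_integral => t _ /=; congr EFin; ring.
rewrite expectationD ?expectationB ?expectation_cst ?expectationZl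
  ?cst1 ?rpredB ?cst1 ?Lfun_scale//.
(* The expanded side is a real number, which excludes an infinite [I] and allows halving. *)
rewrite -Ea -Eb -Eab; case: I => [r||]//=.
by rewrite -!EFinD => -[e]; congr EFin; lra.
Qed.

(** * Products in conjugate spaces and bilinearity of covariance *)

Lemma Lfun_mul_Lfuny d (T : measurableType d) (R : realType)
    (mu : probability T R) (f g : T -> R) :
  f \in Lfun mu 1 -> g \in Lfun mu +oo -> (f \* g)%R \in Lfun mu 1.
Proof.
move=> f1 /andP[]; rewrite !inE/= => mg.
rewrite /finite_norm unlock /= probability_setT lte01.
move=> /ess_supr_bounded[M gM].
have mf : measurable_fun setT f by move/sub_Lfun_mfun : f1; rewrite inE.
(* [M] bounds [|g|] almost everywhere, so [M f] dominates [f g]. *)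
have /Lfun1_integrable/integrableP[_ Mfoo] := Lfun_scale M (lexx _) f1.
apply/Lfun1_integrable/integrableP; split.
  by apply/measurable_EFinP; exact: measurable_funM.
apply: le_lt_trans Mfoo; apply: ae_ge0_le_integral => //.
- by apply/measurableT_comp => //; apply/measurable_EFinP/measurable_funM.
- by apply/measurableT_comp => //; apply/measurable_EFinP/measurable_funM.
apply: filterS gM => t gtM _ /=; rewrite lee_fin !normrM.
by rewrite ler_wpM2l// (le_trans gtM)// ler_norm.
Qed.

(** An infinite exponent forces the other to be 1, where essential boundedness suffices; finite
    exponents are Hoelder's inequality. *)
Lemma Lfun_conjugate_mul d (T : measurableType d) (R : realType)
    (mu : probability T R) (p q : \bar R) (f g : T -> R) :
  1 <= p -> 1 <= q -> p^-1 + q^-1 = 1 ->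
  f \in Lfun mu p -> g \in Lfun mu q -> (f \* g)%R \in Lfun mu 1.
Proof.
case: p => [r r1|_ q1|//]; last first.
  rewrite invey add0e => /eqP; rewrite inve_eq1 => /eqP -> fy g1.
  rewrite (_ : _ \* _ = g \* f)%R; first exact: Lfun_mul_Lfuny.
  by apply/funext => t /=; rewrite mulrC.
case: q => [s s1|_|//]; last first.
  rewrite invey adde0 => /eqP; rewrite inve_eq1 => /eqP ->.
  exact: Lfun_mul_Lfuny.
have r0 : (0 < r)%R by rewrite (lt_le_trans ltr01).
have s0 : (0 < s)%R by rewrite (lt_le_trans ltr01).
rewrite !inver !gt_eqF// -EFinD => -[rs].
move=> /andP[]; rewrite !inE/= => mf foo /andP[]; rewrite !inE/= => mg goo.
apply/andP; split; rewrite inE/=; first exact: measurable_funM.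
apply: le_lt_trans (hoelder mu mf mg r0 s0 rs) _.
by rewrite lte_mul_pinfty ?Lnorm_ge0// ge0_fin_numE ?Lnorm_ge0.
Qed.

(** Integrable products replace square integrability, which may fail in part (b) for exponents other
    than 2. *)
Lemma covarianceBl1 d (T : measurableType d) (R : realType)
    (P : probability T R) (X Y Z : T -> R) :
  X \in Lfun P 1 -> Y \in Lfun P 1 -> Z \in Lfun P 1 ->
  (X \* Z)%R \in Lfun P 1 -> (Y \* Z)%R \in Lfun P 1 ->
  covariance P (X \- Y)%R Z = covariance P X Z - covariance P Y Z.
Proof.
move=> X1 Y1 Z1 XZ1 YZ1.
have XYZE : ((X \- Y) * Z = (X \* Z) \- (Y \* Z))%R.
  by apply/funext => t /=; rewrite mulrBl.
rewrite !covarianceE ?XYZE ?rpredB// !expectationB//.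
rewrite -[(X \* Z)%R]/(X * Z)%R -[(Y \* Z)%R]/(Y * Z)%R.
rewrite -(fineK (expectation_fin_num X1)) -(fineK (expectation_fin_num Y1)).
rewrite -(fineK (expectation_fin_num Z1)) -(fineK (expectation_fin_num XZ1)).
rewrite -(fineK (expectation_fin_num YZ1)).
by rewrite -!EFinB; congr EFin; ring.
Qed.

Lemma covariance_cov_kernelB (R : realType) (mu : probability R R)
    (a1 a2 b1 b2 : lcumulative R) (p q : \bar R) :
  1 <= p -> 1 <= q -> p^-1 + q^-1 = 1 ->
  (a1 : R -> R) \in Lfun mu p -> (a2 : R -> R) \in Lfun mu p ->
  (b1 : R -> R) \in Lfun mu q -> (b2 : R -> R) \in Lfun mu q ->
  covariance mu (a1 \- a2)%R (b1 \- b2)%R =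
    iintB (cov_kernel mu) a1 a2 b1 b2.
Proof.
move=> p1 q1 pq a1p a2p b1q b2q.
have mufin := fin_num_measure mu _ measurableT.
have subp := Lfun_subset (lexx 1) p1 mufin p1.
have subq := Lfun_subset (lexx 1) q1 mufin q1.
have Lfg f g (fp : f \in Lfun mu p) (gq : g \in Lfun mu q) :=
  Lfun_conjugate_mul p1 q1 pq fp gq.
have Lgf f g (fp : f \in Lfun mu p) (gq : g \in Lfun mu q) :
    (g \* f)%R \in Lfun mu 1.
  rewrite (_ : _ \* _ = f \* g)%R ?Lfg//.
  by apply/funext => t /=; rewrite mulrC.
have [b1L b2L] := (subq _ b1q, subq _ b2q).
have [a1L a2L] := (subp _ a1p, subp _ a2p).
(* Linearity in the second argument follows from the first by symmetry, hence the reversed products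
   [Lgf]. *)
have covr (a : lcumulative R) : (a : R -> R) \in Lfun mu p ->
    covariance mu a (b1 \- b2)%R =
      iint (cov_kernel mu) a b1 - iint (cov_kernel mu) a b2.
  move=> ap; have aL := subp _ ap; rewrite covarianceC covarianceBl1 ?Lgf//.
  by rewrite 2!(covarianceC _ _ a) !covariance_cov_kernel ?Lfg.
(* One finite term lets the minus sign distribute over a difference in [\bar R]. *)
have I22 : iint (cov_kernel mu) a2 b2 \is a fin_num.
  by rewrite -covariance_cov_kernel ?covariance_fin_num ?Lfg.
have bq : (b1 \- b2)%R \in Lfun mu q by exact: rpredB.
rewrite (covarianceBl1 a1L a2L (subq _ bq) (Lfg _ _ a1p bq) (Lfg _ _ a2p bq)).
have oppB (x y z w : \bar R) : w \is a fin_num ->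
    x - y - (z - w) = x - y - z + w by move=> w0; rewrite fin_num_oppeB// addeA.
by rewrite (covr _ a1p) (covr _ a2p) (oppB _ _ _ _ I22).
Qed.

(** * Transfer to the law of [X], and conclusion *)

Lemma Lfun1_distribution d d' (T : measurableType d) (T' : measurableType d')
    (R : realType) (P : probability T R) (X : {RV P >-> T'}) (f : T' -> R) :
  measurable_fun setT f ->
  (f \in Lfun (distribution P X) 1) = (f \o X \in Lfun P 1).
Proof.
move=> mf; have mfX : measurable_fun setT (f \o X) by exact: measurableT_comp.
have nE : \int[distribution P X]_y `|(EFin \o f) y| =
    \int[P]_x `|(EFin \o (f \o X)) x|.
  rewrite (@ge0_integral_distribution _ _ _ _ _ _ X (abse \o (EFin \o f)))//.
    by apply: measurableT_comp => //; exact/measurable_EFinP.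
  by move=> y; exact: abse_ge0.
apply/idP/idP => [/Lfun1_integrable/integrableP[_ foo]|
                  /Lfun1_integrable/integrableP[_ foo]].
  by apply/Lfun1_integrable/integrableP; split;
    [exact/measurable_EFinP|rewrite -nE].
by apply/Lfun1_integrable/integrableP; split;
  [exact/measurable_EFinP|rewrite nE].
Qed.

(** Change of variables in the three expectations that make up a covariance. *)
Lemma covariance_distribution d d' (T : measurableType d)
    (T' : measurableType d') (R : realType) (P : probability T R)
    (X : {RV P >-> T'}) (f g : T' -> R) :
  f \in Lfun (distribution P X) 1 -> g \in Lfun (distribution P X) 1 ->
  (f \* g)%R \in Lfun (distribution P X) 1 ->
  covariance P (f \o X) (g \o X) = covariance (distribution P X) f g.
Proof.
move=> f1 g1 fg1.
have mfun1 (h : T' -> R) : h \in Lfun (distribution P X) 1 ->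
    measurable_fun setT h by move=> /sub_Lfun_mfun; rewrite inE.
have EE (h : T' -> R) : h \in Lfun (distribution P X) 1 ->
    'E_P[h \o X] = 'E_(distribution P X)[h].
  move=> h1; rewrite unlock.
  rewrite (@integral_distribution _ _ _ _ _ _ X (EFin \o h))//.
    exact/measurable_EFinP/mfun1.
  apply/(Lfun1_integrable P (h \o X)).
  by rewrite -Lfun1_distribution//; exact: mfun1.
have fgX : ((f \o X) * (g \o X) = (f \* g) \o X)%R by [].
rewrite !covarianceE// ?fgX -?Lfun1_distribution//; [|exact: mfun1..].
by rewrite !EE.
Qed.

(* When [X] is not integrable, [fine] turns its mean into the junk value [0];
   the argument only uses that [c] is some real number. *)
Lemma Lfun2_variance d (T : measurableType d) (R : realType)
    (P : probability T R) (X : T -> R) :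
  measurable_fun setT X -> 'V_P[X] < +oo -> X \in Lfun P 2%:E.
Proof.
move=> mX; rewrite /variance !unlock.
set c := fine _ => VX.
have Xc2 : (X \- cst c)%R \in Lfun P 2%:E.
  apply/andP; split; rewrite inE/=; first exact: measurable_funB.
  rewrite /finite_norm unlock poweR_lty//; move: VX; congr (_ < _).
  apply: eq_integral => t _ /=; congr EFin.
  by rewrite powR_mulrn// real_normK ?num_real// expr2.
have -> : X = ((X \- cst c) \+ cst c)%R by apply/funext => t /=; rewrite subrK.
apply: rpredD; first exact: lee1n.
  by move=> le12; exact: Xc2.
by move=> le12; exact: Lfun_cst.
Qed.

Theorem corollary2p2 (R : realType) (d : measure_display)
    (T : measurableType d) (P : probability T R) (X : {RV P >-> R}) :
  let F := fun x : R => fine (cdf X x) in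
  let K := cov_kernel (distribution P X) in
  [/\ forall x y : R, (0 <= K x y)%R,
      forall x y : R, K x y = K y x,
      forall a b : lcumulative R,
        'V_P[a \o X] < +oo -> 'V_P[b \o X] < +oo ->
        covariance P (a \o X) (b \o X)
          = iint (fun x y => F (Num.min x y) - F x * F y)%R a b
        /\ covariance P (a \o X) (b \o X) = iint K a b
    & forall (a1 a2 b1 b2 : lcumulative R) (a b : R -> R) (p q : \bar R),
        a = (a1 \- a2)%R -> b = (b1 \- b2)%R ->
        1 <= p -> 1 <= q -> p^-1 + q^-1 = 1 ->
        (a1 : R -> R) \in Lfun (distribution P X) p ->
        (a2 : R -> R) \in Lfun (distribution P X) p ->
        (b1 : R -> R) \in Lfun (distribution P X) q ->
        (b2 : R -> R) \in Lfun (distribution P X) q ->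
        covariance P (a \o X) (b \o X)
          = iintB (fun x y => F (Num.min x y) - F x * F y)%R a1 a2 b1 b2
        /\ covariance P (a \o X) (b \o X) = iintB K a1 a2 b1 b2].
Proof.
move=> F K.
(* [F] and [dfun] of the law unfold to the same expression, so the two displayed forms coincide. *)
rewrite (_ : (fun x y => F (Num.min x y) - F x * F y)%R = K)//.
split.
- exact: cov_kernel_ge0.
- exact: cov_kernelC.
- move=> a b Va Vb.
  have [ma mb] := (lcumulative_measurable a, lcumulative_measurable b).
  (* Finite variance gives square integrability under [P], thus integrability of [a], [b] and their
     product. *)
  have a2 : a \o X \in Lfun P 2%:E.
    by apply: Lfun2_variance => //; exact: measurableT_comp.
  have b2 : b \o X \in Lfun P 2%:E.
    by apply: Lfun2_variance => //; exact: measurableT_comp.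
  have sub := Lfun_subset12 (fin_num_measure P _ measurableT).
  have a1 : (a : R -> R) \in Lfun (distribution P X) 1.
    by rewrite Lfun1_distribution//; exact: sub.
  have b1 : (b : R -> R) \in Lfun (distribution P X) 1.
    by rewrite Lfun1_distribution//; exact: sub.
  have ab1 : (a \* b)%R \in Lfun (distribution P X) 1.
    rewrite Lfun1_distribution; first exact: Lfun2_mul_Lfun1 a2 b2.
    exact: measurable_funM.
  by rewrite covariance_distribution// covariance_cov_kernel.
- move=> a1 a2 b1 b2 _ _ p q -> -> p1 q1 pq a1p a2p b1q b2q.
  have muT := fin_num_measure (distribution P X) _ measurableT.
  have subp := Lfun_subset (lexx 1) p1 muT p1.
  have subq := Lfun_subset (lexx 1) q1 muT q1.
  have aLp : (a1 \- a2)%R \in Lfun (distribution P X) p by exact: rpredB.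
  have bLq : (b1 \- b2)%R \in Lfun (distribution P X) q by exact: rpredB.
  (* Passing to the law of [X] requires an integrable product. *)
  have abL1 := Lfun_conjugate_mul p1 q1 pq aLp bLq.
  rewrite covariance_distribution ?(subp _ aLp) ?(subq _ bLq)//.
  by rewrite (covariance_cov_kernelB p1 q1 pq).
Qed.
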